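(* Let $d\ge1$ and consider a generic finite collection of affine functions $h_i\colon\mathbb{R}^d\to\mathbb{R}$, $h_i(x)=\langle x,g_i\rangle+c_i$ with $g_i\neq0$. If every chamber of the decomposition of $\mathbb{R}^d$ defined by the hyperplanes $h_i^{-1}(0)$ has heft at least $k$, then the number of chambers with heft exactly $k$ is at most $\binom{d+k}{d}$.
   Context: The hyperplanes $h_i^{-1}(0)$ decompose $\mathbb{R}^d$ into cells; a chamber is a $d$-dimensional cell. The negative side of the $i$-th hyperplane is $h_i^{-1}(-\infty,0]$ and its positive side is $h_i^{-1}[0,\infty)$. The heft of a chamber is the number of hyperplanes that contain the chamber on their positive side. The collection is generic if, for each $1\le p\le d$, at most $p$ of the hyperplanes contain a common $(d-p)$-dimensional affine subspace (in particular at most $d$ hyperplanes pass through any point). *)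

(* Defs.v *)
From mathcomp Require Import all_boot all_order all_algebra.
From mathcomp Require Import boolp classical_sets functions cardinality reals.

Set Implicit Arguments.
Unset Strict Implicit.
Unset Printing Implicit Defensive.

Import Order.TTheory GRing.Theory Num.Theory.

Local Open Scope ring_scope.
Local Open Scope classical_set_scope.

Definition dotp (R : realType) (d : nat) (x y : 'rV[R]_d) : R :=
  \sum_(j < d) x 0 j * y 0 j.

Definition affine_subspace (R : realType) (d m : nat) (L : set 'rV[R]_d) : Prop :=
  exists (x0 : 'rV[R]_d) (U : {vspace 'rV[R]_d}),
    \dim U = m /\ L = [set x | x - x0 \in U].

Definition affine_hull (R : realType) (d : nat) (C : set 'rV[R]_d) :
    set 'rV[R]_d :=
  \bigcap_(L in [set L | (exists m, affine_subspace m L) /\ C `<=` L]) L.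

(* The empty set has no dimension when d > 0. *)
Definition has_dim (R : realType) (d m : nat) (C : set 'rV[R]_d) : Prop :=
  affine_subspace m (affine_hull C).

Definition hyperplane (R : realType) (d : nat) (f : 'rV[R]_d -> R) :
    set 'rV[R]_d := [set x | f x = 0].

Definition positive_side (R : realType) (d : nat) (f : 'rV[R]_d -> R) :
    set 'rV[R]_d := [set x | 0 <= f x].

(* Multiplicities count: since the members of the collection are indexed, the
   case p = 1 forces distinct indices to have distinct hyperplanes. *)
Definition generic (R : realType) (d n : nat) (h : 'I_n -> 'rV[R]_d -> R) : Prop :=
  forall (p : nat) (L : set 'rV[R]_d),
    (1 <= p <= d)%N -> affine_subspace (d - p) L ->
    (#|[set i | `[< L `<=` hyperplane (h i) >]]%SET| <= p)%N.

(* Cells are the (nonempty, relatively open) classes of points with the same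
   position, i.e. on or strictly on one side, with respect to every hyperplane. *)
Definition cell (R : realType) (d n : nat) (h : 'I_n -> 'rV[R]_d -> R)
    (C : set 'rV[R]_d) : Prop :=
  exists x : 'rV[R]_d,
    C = [set y | forall i, Num.sg (h i y) = Num.sg (h i x)].

Definition chamber (R : realType) (d n : nat) (h : 'I_n -> 'rV[R]_d -> R)
    (C : set 'rV[R]_d) : Prop :=
  cell h C /\ has_dim d C.

Definition heft (R : realType) (d n : nat) (h : 'I_n -> 'rV[R]_d -> R)
    (C : set 'rV[R]_d) : nat :=
  #|[set i | `[< C `<=` positive_side (h i) >]]%SET|.

(* Main.v *)
(** For a chamber of heft [k] with positive set [P], let [v] be the point closest
    to the origin in the polyhedron where all [h i] with [i] outside [P] are
    nonpositive, and let [B] be the set of those constraints active at [v]; by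
    genericity [#|B| <= d].  Minimality of [k] makes this polyhedron the closure
    of the chamber, and strict convexity of the norm makes [v] the unique closest
    point already for the constraints in [B].  Hence, if another such chamber
    [(P', v')] has [|v'| <= |v|] and [P'] misses [B], then [v' = v], and comparing
    signs around [v] gives [P' = P].  The pairs [(P, B)], ordered by [|v|],
    thus satisfy the hypotheses of the skew Bollobas theorem, which bounds their
    number by ['C(d + k, d)]. *)
Require Import Defs.
From mathcomp Require Import all_boot all_order all_algebra ring lra.
From mathcomp Require Import boolp classical_sets functions cardinality reals.
From mathcomp Require Import topology normedtype derive.
Set Implicit Arguments.
Unset Strict Implicit.
Unset Printing Implicit Defensive.

Import Order.TTheory GRing.Theory Num.Theory.
Import numFieldNormedType.Exports.

Local Open Scope ring_scope.

(** * Skew Bollobas theorem by the polynomial method *)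

Lemma weight_triangular_row_free (F : fieldType) (dO : Order.disp_t)
    (O : orderType dO) (m : nat) (M : 'M[F]_m) (w : 'I_m -> O) :
  (forall i, M i i != 0) ->
  (forall i j, i != j -> (w i <= w j)%O -> M i j = 0) -> row_free M.
Proof.
move=> Mdiag Mtri; apply/inj_row_free => u uM0.
apply/eqP/contraT => /eqP u_neq0.
have [j0 uj0] : exists j, u 0 j != 0.
  apply/existsP; apply/contraT; rewrite negb_exists => /forallP u0.
  by case: u_neq0; apply/rowP => j; move/negPn/eqP: (u0 j) => ->; rewrite mxE.
(* In column [j], for [j] of maximal weight in the support of [u], only the diagonal term
   survives. *)
have [j uj wmax] := @arg_maxP _ O _ j0 (fun j => u 0 j != 0) w uj0.
have /eqP := congr1 (fun v : 'rV_m => v 0 j) uM0.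
rewrite !mxE (bigD1 j) //= big1 ?addr0 => [|i neq_ij].
  by rewrite mulf_eq0 (negbTE uj) (negbTE (Mdiag j)).
have [-> | ui] := eqVneq (u 0 i) 0; first exact: mul0r.
by rewrite (Mtri i j) ?mulr0 //; exact: wmax.
Qed.

(** These encode multisets of [k] exponents, that is, the degree-[k] monomials in the coefficients
    of a polynomial of degree at most [d]. *)
Definition sorted_tuples (k d : nat) : {set k.-tuple 'I_d.+1} :=
  [set t : k.-tuple 'I_d.+1 | sorted leq (map val t)].

(** [phi] chooses an exponent in each of [k] factors; sorting forgets which factor made which
    choice, as does the product of the coefficients. *)
Definition sort_ffun (k d : nat) (phi : {ffun 'I_k -> 'I_d.+1}) :
    k.-tuple 'I_d.+1 :=
  sort_tuple (relpre val leq) [tuple phi r | r < k].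

Lemma sort_ffun_sorted (k d : nat) (phi : {ffun 'I_k -> 'I_d.+1}) :
  sort_ffun phi \in sorted_tuples k d.
Proof. by rewrite inE sorted_map; apply: sort_sorted => x y; exact: leq_total. Qed.

Lemma big_sort_ffun (R : comRingType) (k d : nat) (phi : {ffun 'I_k -> 'I_d.+1})
    (F : 'I_d.+1 -> R) :
  \prod_(e <- sort_ffun phi) F e = \prod_(r < k) F (phi r).
Proof.
rewrite (perm_big [tuple phi r | r < k]); last by rewrite perm_sort.
by rewrite big_tuple; apply: eq_bigr => r _; rewrite tnth_mktuple.
Qed.

(* Expanding the product, the monomials in the coefficients of [p] are indexed
   by sorted tuples, so [p] and [s] are separated by [#|sorted_tuples|] terms. *)
Lemma prod_horner_sorted (R : comRingType) (k d : nat) (p : {poly R}) (s : seq R) :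
  (size p <= d.+1)%N -> size s = k ->
  \prod_(x <- s) p.[x] =
  \sum_(t in sorted_tuples k d)
    (\sum_(phi | sort_ffun phi == t) \prod_(r < k) s`_r ^+ phi r) *
    \prod_(e <- t) p`_e.
Proof.
move=> sz_p sz_s; rewrite (big_nth 0) sz_s big_mkord.
under eq_bigr do rewrite (horner_coef_wide _ sz_p).
rewrite bigA_distr_bigA (partition_big (@sort_ffun k d) (mem (sorted_tuples k d))) /=.
  apply: eq_bigr => t _; rewrite mulr_suml; apply: eq_bigr => phi /eqP <-.
  by rewrite big_sort_ffun -big_split; apply: eq_bigr => r _; rewrite mulrC.
by move=> phi _; exact: sort_ffun_sorted.
Qed.

(* The matrix of the [\prod_(a in A i) \prod_(b in B j) (a - b)] is triangular
   with nonzero diagonal, and factors through [sorted_tuples k d]. *)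
Lemma skew_bollobas (dO : Order.disp_t) (O : orderType dO) (n m k d : nat)
    (A B : 'I_m -> {set 'I_n}) (w : 'I_m -> O) :
  (forall i, #|A i| = k) -> (forall i, #|B i| <= d)%N ->
  (forall i, [disjoint A i & B i]) ->
  (forall i j, i != j -> (w i <= w j)%O -> ~~ [disjoint A i & B j]) ->
  (m <= 'C(d + k, d))%N.
Proof.
move=> cardA cardB disjAB skew.
(* Ground elements become rationals, distinct in characteristic 0; [p j] has root set [B j]. *)
pose p j : {poly rat} := \prod_(b in B j) ('X - (b%:R)%:P).
pose s i : seq rat := [seq a%:R | a : 'I_n <- enum (A i)].
pose M : 'M[rat]_m := \matrix_(i, j) \prod_(x <- s i) (p j).[x].
have ME i j : M i j = \prod_(a in A i) \prod_(b in B j) (a%:R - b%:R).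
  rewrite mxE big_map big_enum /=; apply: eq_bigr => a _.
  by rewrite horner_prod; apply: eq_bigr => b _; rewrite hornerXsubC.
have freeM : row_free M.
  apply: (weight_triangular_row_free (w := w)) => [i|i j neq_ij le_w].
    rewrite ME; apply/prodf_neq0 => a aA; apply/prodf_neq0 => b bB.
    rewrite subr_eq0 eqr_nat; apply: contraL bB => /eqP/val_inj <-.
    by rewrite (disjointFr (disjAB i) aA).
  have /pred0Pn [a /andP[/= aA aB]] := skew i j neq_ij le_w.
  by rewrite ME (bigD1 a) //= (bigD1 a) //= subrr !mul0r.
pose S := sorted_tuples k d.
pose U : 'M[rat]_(m, #|S|) := \matrix_(i, t)
  \sum_(phi | sort_ffun phi == enum_val t) \prod_(r < k) (s i)`_r ^+ phi r.
pose V : 'M[rat]_(#|S|, m) := \matrix_(t, j) \prod_(e <- (enum_val t : k.-tuple 'I_d.+1)) (p j)`_e.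
have MUV : M = U *m V.
  apply/matrixP => i j; rewrite !mxE (@prod_horner_sorted _ k d).
  - by rewrite big_enum_val; apply: eq_bigr => t _; rewrite !mxE.
  - rewrite /p -big_enum /= -(big_map (fun b : 'I_n => b%:R) predT (fun x => 'X - x%:P)).
    by rewrite size_prod_XsubC size_map -cardE ltnS.
  by rewrite size_map -cardE cardA.
(* The rank of [M] is [m], but at most the inner dimension [#|S|]. *)
have := mxrankM_maxl U V.
move: freeM; rewrite /row_free -MUV => /eqP ->.
move=> /leq_trans /(_ (rank_leq_col _)); rewrite /S.
by rewrite card_sorted_tuples -bin_sub ?leq_addr // addKn addnC.
Qed.

Local Open Scope classical_set_scope.
Local Open Scope card_scope.

(** * Inner product and nearest points *)

Section Dotp.
Variables (R : realType) (d : nat).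
Implicit Types x y z : 'rV[R]_d.

Lemma dotpC x y : dotp x y = dotp y x.
Proof. by apply: eq_bigr => j _; rewrite mulrC. Qed.

Lemma dotpDl x y z : dotp (x + y) z = dotp x z + dotp y z.
Proof. by rewrite -big_split; apply: eq_bigr => j _; rewrite mxE mulrDl. Qed.

Lemma dotpZl (a : R) x y : dotp (a *: x) y = a * dotp x y.
Proof. by rewrite mulr_sumr; apply: eq_bigr => j _; rewrite mxE mulrA. Qed.

Lemma dotpNl x y : dotp (- x) y = - dotp x y.
Proof. by rewrite -scaleN1r dotpZl mulN1r. Qed.

Lemma dotpDr x y z : dotp x (y + z) = dotp x y + dotp x z.
Proof. by rewrite !(dotpC x) dotpDl. Qed.

Lemma dotpZr (a : R) x y : dotp x (a *: y) = a * dotp x y.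
Proof. by rewrite !(dotpC x) dotpZl. Qed.

Lemma dotpNr x y : dotp x (- y) = - dotp x y.
Proof. by rewrite !(dotpC x) dotpNl. Qed.

Lemma dotp_ge0 x : 0 <= dotp x x.
Proof. by apply: sumr_ge0 => j _; rewrite -expr2 sqr_ge0. Qed.

Lemma dotp_eq0 x : (dotp x x == 0) = (x == 0).
Proof.
apply/idP/eqP => [|->]; last by rewrite /dotp big1 // => j _; rewrite mxE mul0r.
rewrite psumr_eq0 => [/allP x0|j _]; last by rewrite -expr2 sqr_ge0.
by apply/rowP => j; rewrite mxE; have := x0 j (mem_index_enum _);
  rewrite /= mulf_eq0 orbb => /eqP.
Qed.

Lemma continuous_dotp (f g : 'rV[R]_d -> 'rV[R]_d) :
  continuous f -> continuous g -> continuous (fun x => dotp (f x) (g x)).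
Proof.
move=> cf cg; apply: continuous_big => [|j _ x]; first exact: add_continuous.
apply: (@continuousM _ _ (fun y => f y 0 j) (fun y => g y 0 j)).
  by apply: (@continuous_comp _ _ _ f (fun y : 'rV[R]_d => y 0 j)); [exact: cf|exact: coord_continuous].
by apply: (@continuous_comp _ _ _ g (fun y : 'rV[R]_d => y 0 j)); [exact: cg|exact: coord_continuous].
Qed.

(** Bounds the max norm, in which compactness is phrased, by the Euclidean one. *)
Lemma coord_le_dotp x j : `|x 0 j| <= 1 + dotp x x.
Proof.
have : x 0 j ^+ 2 <= dotp x x.
  rewrite /dotp (bigD1 j) //= -expr2 lerDl.
  by apply: sumr_ge0 => i _; rewrite -expr2 sqr_ge0.
by rewrite -(real_normK (num_real _)); have := normr_ge0 (x 0 j); nra.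
Qed.

Lemma closed_nearest_origin (Q : set 'rV[R]_d) :
  Q !=set0 -> closed Q ->
  exists2 v, Q v & forall y, Q y -> dotp v v <= dotp y y.
Proof.
move=> [x0 Qx0] clQ.
have cn : continuous (fun x : 'rV[R]_d => dotp x x).
  by apply: continuous_dotp => x; exact: cvg_id.
(* Cutting [Q] by the ball through [x0] gives a compact set and discards only points farther away
   than [x0]. *)
pose A := Q `&` [set x | dotp x x <= dotp x0 x0].
have [] := @compact_EVT_min _ R (fun x : 'rV[R]_d => dotp x x) A.
- by exists x0; split => /=.
- apply: bounded_closed_compact.
    exists (1 + dotp x0 x0); split; first exact: num_real.
    move=> M ltM x [_ /= nx]; apply: ltW; apply: le_lt_trans ltM.
    rewrite [leLHS]/Num.Def.normr /= mx_normrE; apply/bigmax_leP; split => [|[i j] _] /=.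
      by rewrite addr_ge0 ?dotp_ge0.
    rewrite (ord1 i); apply: (le_trans (coord_le_dotp x j)).
    by rewrite lerD2l.
  apply: closedI => //.
  apply: (@preimage_closed _ _ (fun x : 'rV[R]_d => dotp x x)
    [set y | y <= dotp x0 x0]); last exact: closed_le.
  by move=> x _; exact: cn.
- exact: continuous_subspaceT.
move=> v; rewrite inE => -[Qv /= nv] vmin; exists v => // y Qy.
have [ny|/ltW ny] := leP (dotp y y) (dotp x0 x0); last exact: le_trans ny.
by apply: vmin; rewrite inE; split.
Qed.
End Dotp.

(** * Signs and chambers of an arrangement *)

Lemma small_step_sg (R : realFieldType) (n : nat) (a b : 'I_n -> R) :
  exists2 t, 0 < t < 1 & forall i,
    Num.sg ((1 - t) * a i + t * b i) =
    if a i == 0 then Num.sg (b i) else Num.sg (a i).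
Proof.
pose r i := `|b i| / `|a i|.
have r_ge0 i : 0 <= r i by rewrite divr_ge0.
(* With [t = s^-1], and up to the factor [t], [a i] gets weight [s - 1 > r i], so it decides the
   sign when nonzero; the constant 2 keeps [t] below 1. *)
pose s := 2 + \sum_i r i.
have s_ge2 : 2 <= s by rewrite lerDl sumr_ge0.
have s_gt0 : 0 < s by lra.
exists s^-1 => [|i]; first by rewrite invr_gt0 s_gt0 invf_lt1 //; lra.
have -> : (1 - s^-1) * a i + s^-1 * b i = s^-1 * ((s - 1) * a i + b i).
  by field; rewrite gt_eqF.
rewrite sgrM gtr0_sg ?invr_gt0 // mul1r.
case: eqVneq => [->|ai_neq0]; first by rewrite mulr0 add0r.
have : `|b i| < (s - 1) * `|a i|.
  rewrite -ltr_pdivrMr ?normr_gt0 // -/(r i) /s (bigD1 i) //=.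
  have : 0 <= \sum_(j < n | j != i) r j by rewrite sumr_ge0.
  lra.
rewrite ltr_norml => /andP[lb ub].
case: (ltgtP (a i) 0) ai_neq0 => // ai _.
  by rewrite (ltr0_sg ai) ltr0_sg //; rewrite ltr0_norm // in ub; lra.
by rewrite (gtr0_sg ai) gtr0_sg //; rewrite gtr0_norm // in lb; lra.
Qed.

Section Arrangement.
Variables (R : realType) (d n : nat).
Variables (g : 'I_n -> 'rV[R]_d) (c : 'I_n -> R) (h : 'I_n -> 'rV[R]_d -> R).
Hypothesis hE : forall i x, h i x = dotp x (g i) + c i.
Implicit Types (x y v w : 'rV[R]_d) (C : set 'rV[R]_d).

Definition pos_set x : {set 'I_n} := [set i | 0 < h i x]%SET.

Definition cell_of x : set 'rV[R]_d :=
  [set y | forall i, Num.sg (h i y) = Num.sg (h i x)].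

Lemma affine_line i v w (t : R) :
  h i (v + t *: (w - v)) = (1 - t) * h i v + t * h i w.
Proof. by rewrite !hE !(dotpDl, dotpZl, dotpNl); ring. Qed.

Lemma small_move v w : exists2 t, 0 < t < 1 & forall i,
  Num.sg (h i (v + t *: (w - v))) =
  if h i v == 0 then Num.sg (h i w) else Num.sg (h i v).
Proof.
have [t t01 tP] := small_step_sg (h^~ v) (h^~ w).
by exists t => // i; rewrite affine_line tP.
Qed.

Lemma dim_fullrV : \dim {:'rV[R]_d} = d.
Proof. by rewrite dimvf; exact: mul1n. Qed.

Lemma has_dim_full (C : set 'rV[R]_d) :
  has_dim d C -> affine_hull C = setT.
Proof.
move=> [x0 [U [dimU ->]]]; apply/seteqP; split => // y _ /=.
suff -> : U = fullv by rewrite memvf.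
by apply/eqP; rewrite eqEdim subvf dim_fullrV dimU /= leqnn.
Qed.

(** Makes the hyperplane a competitor in the intersection defining [affine_hull]. *)
Lemma hyperplane_affine i x : h i x = 0 ->
  exists m, affine_subspace m (hyperplane (h i)).
Proof.
move=> hx0; pose U := lker (linfun (mulmxr (g i)^T : 'rV[R]_d -> 'rV[R]_1)).
exists (\dim U), x, U; split=> //; apply/funext => y; apply/propext.
have UE : (y - x \in U) = (h i y == 0).
  rewrite memv_ker lfunE /= -subr_eq0 subr0.
  have -> : h i y = dotp (y - x) (g i).
    by move: hx0; rewrite dotpDl dotpNl !hE => hx0; lra.
  apply/eqP/eqP => [/rowP/(_ 0)|E0].
    rewrite !mxE => <-; apply: eq_bigr => j _; by rewrite !mxE.
  apply/rowP => j; rewrite ord1 !mxE -[RHS]E0.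
  by apply: eq_bigr => k _; rewrite !mxE.
by rewrite /hyperplane /mkset UE; split => /eqP.
Qed.

Lemma chamberP C : (forall i, g i != 0) ->
  chamber h C <-> exists2 x, (forall i, h i x != 0) & C = cell_of x.
Proof.
move=> g_neq0; split=> [[[x ->]]|[x hx ->]].
  move=> /has_dim_full hullT; exists x => // i; apply/eqP => hx0.
  (* A cell meeting a hyperplane lies in it, and so does its hull, yet [x + g i] is off the
     hyperplane. *)
  have [m Hm] := hyperplane_affine hx0.
  have hullx : affine_hull (cell_of x) (x + g i) by rewrite hullT.
  have /eqP : h i (x + g i) = 0.
    apply: (hullx (hyperplane (h i))); split; first by exists m.
    by move=> y /(_ i); rewrite hx0 sgr0 => /eqP; rewrite sgr_eq0 => /eqP.
  rewrite hE dotpDl addrAC -hE hx0 add0r.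
  by rewrite dotp_eq0 (negbTE (g_neq0 i)).
split; first by exists x.
exists 0, fullv; split; first exact: dim_fullrV.
apply/seteqP; split => y _ /=; first by rewrite memvf.
move=> L [[m [x0 [U [_ ->]]]] sub].
(* A short move from [x] towards any [y] stays in the cell, so [y - x] is a direction of every [L]
   containing the cell. *)
have [t /andP[t_gt0 _] tP] := small_move x y.
have zU : x + t *: (y - x) - x0 \in U.
  by apply: sub => i; rewrite tP (negbTE (hx i)).
have xU : x - x0 \in U by exact: sub.
rewrite /= -(subrK x y) -addrA memvD //.
have := memvB zU xU; rewrite opprB addrA subrK addrC addKr.
by rewrite rpredZeq gt_eqF.
Qed.

Lemma heft_cell_of x : (forall i, h i x != 0) -> heft h (cell_of x) = #|pos_set x|.
Proof.
move=> hx; apply: eq_card => i; rewrite !inE.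
apply/asboolP/idP => [sub|hpos y /(_ i) yP].
  by rewrite lt_neqAle eq_sym hx; apply: sub.
by apply/ltW; rewrite -sgr_gt0 yP sgr_gt0.
Qed.

(* [v] is the point of [\bigcap_(h i x < 0) {h i <= 0}] closest to the origin;
   the last clause says that the constraints active at [v] already force it. *)
Lemma nearest_point (k : nat) x :
  (forall y, (forall i, h i y != 0) -> (k <= #|pos_set y|)%N) ->
  (forall i, h i x != 0) -> #|pos_set x| = k ->
  exists v, [/\ forall i, h i x < 0 -> h i v <= 0,
    forall i, 0 < h i x -> 0 <= h i v &
    forall w, (forall i, h i x < 0 -> h i v = 0 -> h i w <= 0) ->
      dotp w w <= dotp v v -> w = v].
Proof.
move=> hmin hx cardx.
pose Q := \bigcap_(i in [set i | h i x < 0]) [set y | h i y <= 0].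
have [||v Qv vmin] := @closed_nearest_origin R d Q.
- by exists x => i /ltW.
- apply: closed_bigI => i _.
  apply: (@preimage_closed _ _ (h i) [set y | y <= 0]); last exact: closed_le.
  move=> y _; rewrite (_ : h i = fun y => dotp y (g i) + c i); last first.
    by apply/funext => z; exact: hE.
  apply: (@continuousD _ _ _ (fun y => dotp y (g i)) (cst (c i))); last exact: cst_continuous.
  by apply: (@continuous_dotp _ _ id (cst (g i))) => z; [exact: cvg_id|exact: cst_continuous].
exists v; split => // [i hix|w wP le_wv].
  rewrite leNgt; apply/negP => hiv.
  (* Otherwise a short move from [v] towards [x] reaches a chamber whose positive set lies in that
     of [x] and misses [i], against minimality of [k]. *)
  have [t _ tP] := small_move v x; set y := v + _ in tP.
  have hy j : h j y != 0.
    by rewrite -sgr_eq0 tP; case: ifPn => [_|]; rewrite sgr_eq0.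
  have := hmin y hy; rewrite -cardx leqNgt => /negP; apply.
  apply: proper_card; apply/properP; split.
    apply/fintype.subsetP => j; rewrite !inE -sgr_gt0 tP.
    case: eqP => [_|_]; rewrite sgr_gt0 // => hjv.
    rewrite ltNge le_eqVlt (negbTE (hx j)) /=.
    by apply: contraL hjv => hjx; rewrite -leNgt; exact: Qv.
  exists i; rewrite !inE // -sgr_gt0 tP lt_eqF // sgr_gt0 -leNgt; exact: ltW.
(* Constraints inactive at [v] have slack there, so the move stays in [Q]. *)
have [t /andP[t_gt0 t_lt1] tP] := small_move v w; set y := v + _ in tP.
have /vmin : Q y.
  move=> i /= hix; rewrite -sgr_le0 tP; case: eqP => hiv; rewrite sgr_le0.
    exact: wP.
  exact: Qv.
(* Strict convexity as an identity; its last term forces [w = v]. *)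
have -> : dotp y y = (1 - t) * dotp v v + t * dotp w w
                     - t * (1 - t) * dotp (w - v) (w - v).
  rewrite /y !(dotpDl, dotpDr, dotpZl, dotpZr, dotpNl, dotpNr) (dotpC w v); ring.
move=> le_vy; apply/eqP; rewrite -subr_eq0 -dotp_eq0 eq_le dotp_ge0 andbT.
have tt : 0 < t * (1 - t) by rewrite mulr_gt0 // subr_gt0.
rewrite -(pmulr_rle0 _ tt).
have : t * (dotp w w - dotp v v) <= 0 by rewrite pmulr_rle0 // subr_le0.
lra.
Qed.

End Arrangement.

(** * Genericity and the count of chambers *)

Lemma generic_point (R : realType) (d n : nat) (h : 'I_n -> 'rV[R]_d -> R) v :
  (1 <= d)%N -> generic h -> (#|[set i | h i v == 0%R]%SET| <= d)%N.
Proof.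
move=> d_gt0 hgen.
have aff : affine_subspace (d - d) [set v].
  exists v, 0%VS; rewrite subnn dimv0; split=> //.
  by apply/seteqP; split=> y /=; rewrite memv0 subr_eq0 => /eqP.
apply: leq_trans (hgen d [set v] _ aff); last by rewrite d_gt0 leqnn.
apply: subset_leq_card; apply/fintype.subsetP => i.
by rewrite !inE => /eqP hv y ->.
Qed.

Theorem theorem14 (R : realType) (d n k : nat)
    (g : 'I_n -> 'rV[R]_d) (c : 'I_n -> R) (h : 'I_n -> 'rV[R]_d -> R)
    (hd : (1 <= d)%N)
    (hE : forall i x, h i x = dotp x (g i) + c i)
    (hg : forall i, g i != 0)
    (hgen : generic h)
    (hk : forall C : set 'rV[R]_d, chamber h C -> (k <= heft h C)%N) :
  [set C : set 'rV[R]_d | chamber h C /\ heft h C = k] #<= `I_('C(d + k, d)).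
Proof.
have hmin y : (forall i, h i y != 0) -> (k <= #|pos_set h y|)%N.
  move=> hy; rewrite -heft_cell_of //; apply: hk.
  by apply/(chamberP hE) => //; exists y.
(* Chambers are counted through their positive sets, which determine all signs off the
   hyperplanes. *)
pose F : {set {set 'I_n}} := [set P : {set 'I_n} | (#|P| == k)%N &&
  `[< exists2 x, (forall i, h i x != 0) & pos_set h x = P >]]%SET.
have ex_xv (i : 'I_#|F|) : exists xv : 'rV[R]_d * 'rV[R]_d,
  [/\ forall l, h l xv.1 != 0, pos_set h xv.1 = enum_val i,
    forall l, h l xv.1 < 0 -> h l xv.2 <= 0,
    forall l, 0 < h l xv.1 -> 0 <= h l xv.2 &
    forall w, (forall l, h l xv.1 < 0 -> h l xv.2 = 0 -> h l w <= 0) ->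
      dotp w w <= dotp xv.2 xv.2 -> w = xv.2].
  have := enum_valP i; rewrite inE => /andP[/eqP cardP /asboolP[x hx posx]].
  have cardx : #|pos_set h x| = k by rewrite posx.
  by have [v [? ? ?]] := nearest_point hE hmin hx cardx; exists (x, v).
have [xv xvP] := choice ex_xv.
pose B i := [set l | (h l (xv i).1 < 0) && (h l (xv i).2 == 0)]%SET.
have le_F : (#|F| <= 'C(d + k, d))%N.
  apply: (@skew_bollobas _ R n #|F| k d enum_val B
    (fun i => dotp (xv i).2 (xv i).2)) => [i|i|i|i j neq_ij le_ij].
  - by have := enum_valP i; rewrite inE => /andP[/eqP].
  - apply: leq_trans (generic_point (xv i).2 hd hgen).
    by apply: subset_leq_card; apply/fintype.subsetP => l; rewrite !inE => /andP[].
  - have [_ <- _ _ _] := xvP i; apply/pred0P => l /=; rewrite !inE.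
    by case: ltgtP; rewrite ?andbF.
  have [hxi posi negvi posvi _] := xvP i; have [hxj posj negvj posvj vminj] := xvP j.
  apply: contra neq_ij => /pred0P disj.
  (* Constraints active at [v_j] are thus negative at [x_i], hence nonpositive at [v_i], which makes
     [v_i] a competitor of [v_j]. *)
  have disjE l : h l (xv j).1 < 0 -> h l (xv j).2 = 0 -> h l (xv i).1 < 0.
    move=> hlj hlv; have := disj l; rewrite /= -posi !inE hlj hlv eqxx !andbT.
    by move/negbT; rewrite -leNgt le_eqVlt (negbTE (hxi l)).
  have vE : (xv i).2 = (xv j).2.
    by apply: vminj => // l hlj hlv; apply/negvi/disjE.
  apply/eqP/enum_val_inj/eqP; rewrite eqEcard.
  have cardF (r : 'I_#|F|) : #|enum_val r : {set _}| = k.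
    by have := enum_valP r; rewrite inE => /andP[/eqP].
  rewrite !cardF leqnn andbT -posi -posj; apply/fintype.subsetP => l; rewrite !inE => hli.
  (* If [h l] were positive at [x_i] and negative at [x_j], it would vanish at the common nearest
     point, contradicting [disjE]. *)
  rewrite ltNge le_eqVlt (negbTE (hxj l)) /=; apply/negP => hlj.
  have hlv : h l (xv j).2 = 0.
    by apply/eqP; rewrite eq_le negvj //= -vE posvi.
  by have := disjE l hlj hlv; rewrite ltNge (ltW hli).
apply: (@card_le_trans _ _ _ ((fun i => cell_of h (xv i).1) @` [set: 'I_#|F|])).
  apply: subset_card_le => _ [/(chamberP hE)[//|x hx ->]].
  rewrite heft_cell_of // => cardx.
  have xF : pos_set h x \in F.
    by rewrite inE cardx eqxx; apply/asboolP; exists x.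
  exists (enum_rank_in xF (pos_set h x)) => //.
  have [hx' posE _ _ _] := xvP (enum_rank_in xF (pos_set h x)).
  apply/funext => y; apply/propext.
  suff sgE l : Num.sg (h l (xv (enum_rank_in xF (pos_set h x))).1) = Num.sg (h l x).
    by split=> yP l; rewrite yP sgE.
  move/setP/(_ l): posE; rewrite enum_rankK_in // !inE.
  have sg_pos (z : R) : z != 0 -> Num.sg z = if 0 < z then 1 else -1.
    by case: sgrP.
  by rewrite !sg_pos // => ->.
apply: (card_le_trans (card_image_le _ _)).
rewrite -card_le_II in le_F; apply: card_le_trans le_F.
by have := @card_II #|F|; rewrite card_eq_le => /andP[].
Qed.
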